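(* $t(n)\in\Omega\left(n^2/\log(n)\right)$.
   Context: Let $\mathfrak{C}=\{0,1\}^n$ be the vertex set of the $n$-dimensional hypercube; $\oplus,\wedge$ denote bitwise XOR and AND. An outmap is any function $s:\mathfrak{C}\to\{0,1\}^n$. A clash of $s$ is a pair of distinct vertices $u,v$ with $(s(u)\oplus s(v))\wedge(u\oplus v)=0^n$. A query at $u$ to the oracle for $s$ returns $s(u)$; algorithms choose queries adaptively, and only the number of queries is counted. \textsc{Sink-or-Clash}: given oracle access to an arbitrary outmap $s$, query either a vertex $u$ with $s(u)=0^n$ or both vertices of some clash. $t(n)=\min_{\mathcal A}\max_s t(\mathcal A,s)$, where $\mathcal A$ ranges over deterministic algorithms solving \textsc{Sink-or-Clash} on all outmaps of the $n$-cube and $t(\mathcal A,s)$ is the number of queries made on $s$. *)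

(* Defs.v *)
From HB Require Import structures.
From mathcomp Require Import all_boot all_order all_algebra.
From mathcomp Require Import all_classical all_reals all_analysis.

Set Implicit Arguments.
Unset Strict Implicit.
Unset Printing Implicit Defensive.

Import Order.TTheory GRing.Theory Num.Theory.
Import numFieldNormedType.Exports.

Definition cube (n : nat) := {ffun 'I_n -> bool}.

Definition zero_vec (n : nat) : cube n := [ffun => false].
Definition xor_vec (n : nat) (u v : cube n) : cube n :=
  [ffun i => u i (+) v i].
Definition and_vec (n : nat) (u v : cube n) : cube n :=
  [ffun i => u i && v i].

Definition outmap (n : nat) := {ffun cube n -> cube n}.

Definition is_sink (n : nat) (s : outmap n) (u : cube n) : bool :=
  s u == zero_vec n.

Definition is_clash (n : nat) (s : outmap n) (u v : cube n) : bool :=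
  (u != v) && (and_vec (xor_vec (s u) (s v)) (xor_vec u v) == zero_vec n).

(* A deterministic adaptive algorithm is a decision tree: it either stops, or
   queries a vertex and continues in a way determined by the answers so far.
   Every branch of such a tree is finite, so termination is built in. *)
Inductive algorithm (n : nat) : Type :=
| Stop
| Query of cube n & (cube n -> algorithm n).
Arguments Stop {n}.

Fixpoint queries (n : nat) (A : algorithm n) (s : outmap n) : seq (cube n) :=
  match A with
  | Stop => [::]
  | Query u next => u :: queries (next (s u)) s
  end.

Definition found (n : nat) (s : outmap n) (q : seq (cube n)) : bool :=
  [exists u in q, is_sink s u]
  || [exists u in q, exists v in q, is_clash s u v].

Definition solves_sink_or_clash (n : nat) (A : algorithm n) : bool :=
  [forall s : outmap n, found s (queries A s)].

Definition nqueries (n : nat) (A : algorithm n) (s : outmap n) : nat :=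
  size (queries A s).

Definition worst_case (n : nat) (A : algorithm n) : nat :=
  \max_(s : outmap n) nqueries A s.

Definition attainable (n : nat) : pred nat :=
  fun k => `[< exists A : algorithm n,
                 solves_sink_or_clash A /\ worst_case A = k >].

(* The minimum is over a nonempty set: an outmap without a clash is injective,
   hence bijective, hence has a sink, so querying every vertex is a solution. *)
Lemma attainable_exists (n : nat) : exists k, attainable n k.
Proof.
pose A := foldr (fun u B => Query u (fun=> B)) Stop (enum (cube n)).
exists (worst_case A); apply/asboolP; exists A; split=> //.
apply/forallP => s.
have qE : queries A s = enum (cube n).
  by rewrite /A; elim: (enum (cube n)) => //= u l ->.
rewrite qE /found.
case: (boolP [exists u in enum (cube n), exists v in enum (cube n),
  is_clash s u v]) => [|noclash]; first by rewrite orbT.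
have inj_s : injective s.
  move=> u v suv; apply/eqP; apply: contraNT noclash => neq_uv.
  apply/existsP; exists u; rewrite mem_enum /=.
  apply/existsP; exists v; rewrite mem_enum /=.
  rewrite /is_clash neq_uv /=; apply/eqP/ffunP => i.
  by rewrite !ffunE suv addbb.
have [g _ gK] := injF_bij inj_s.
rewrite orbF; apply/existsP; exists (g (zero_vec n)).
by rewrite mem_enum /= /is_sink gK.
Qed.

Definition t (n : nat) : nat := ex_minn (attainable_exists n).

(* Main.v *)
(* Adversary argument, following Schurr and Szabo. While answering m queries
   the adversary maintains a set L of at most m directions and a clash-free
   orientation depending only on the coordinates in L, all other directions
   being outgoing. When two queries agree on L, one direction in which they
   differ is added to L. Enlarge L to size n'. If 2 ^ (n - n') exceeds m, some
   n'-dimensional face with directions L contains none of the queries, and the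
   answers extend to a clash-free orientation in which the face is a
   hypersink: its vertices have no outgoing edge outside L, and each vertex
   outside the face has one towards it. So an arbitrary outmap of the n'-cube
   can be implanted in the face without creating a sink or a clash that
   involves outside vertices, whence t n >= m + t n'. Iterating about n / (4
   log n) times with m about n / 2 gives the bound. *)
Require Import Defs.
From HB Require Import structures.
From mathcomp Require Import all_boot all_order all_algebra.
From mathcomp Require Import all_classical all_reals all_analysis.
From mathcomp Require Import zify lra.
Import numFieldNormedType.Exports.

Set Implicit Arguments.
Unset Strict Implicit.
Unset Printing Implicit Defensive.

Import Order.TTheory GRing.Theory Num.Theory.

(** * Agreement of vertices on a set of directions; localised absence of clashes *)

Section Agreement.
Variable n : nat.
Implicit Types (D L : {set 'I_n}) (s : outmap n) (u v w : cube n).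

Definition agree D u v : bool := [forall i in D, u i == v i].

(** Localising to [D] matters: a separation found inside [L] survives any later change of the
    answers in directions outside [L]. *)
Definition separated D s u v : bool :=
  [exists i in D, (u i != v i) && (s u i != s v i)].

Lemma agreeP D u v : reflect {in D, u =1 v} (agree D u v).
Proof.
by apply: (iffP forall_inP) => H i /H => [/eqP|->].
Qed.

Lemma agreexx D u : agree D u u.
Proof. exact/agreeP. Qed.

Lemma agree_sym D u v : agree D u v = agree D v u.
Proof. by apply: eq_forallb => i; rewrite eq_sym. Qed.

Lemma agree_trans D : transitive (agree D).
Proof.
by move=> v u w /agreeP uv /agreeP vw; apply/agreeP => i iD; rewrite uv ?vw.
Qed.

Lemma agree_eql D u v : agree D u v -> agree D u =1 agree D v.
Proof.
move=> uv w; apply/idP/idP; first by apply: agree_trans; rewrite agree_sym.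
exact: agree_trans.
Qed.

Lemma agreeU1 D i u v : agree (i |: D) u v = (u i == v i) && agree D u v.
Proof.
apply/agreeP/andP => [uv|[/eqP ui /agreeP uv] j]; last first.
  by rewrite !inE => /orP[/eqP ->|/uv].
split; first by rewrite uv ?setU11.
by apply/agreeP => j jD; rewrite uv // setU1r.
Qed.

Lemma agree_setC D u v : agree D u v -> agree (~: D) u v -> u = v.
Proof.
move=> /agreeP uv /agreeP uv'; apply/ffunP => i.
by case: (boolP (i \in D)) => [/uv//|iD]; rewrite uv' // inE.
Qed.

Lemma separatedS D D' s u v :
  D \subset D' -> separated D s u v -> separated D' s u v.
Proof.
move=> /fintype.subsetP DD' /exists_inP[i iD h].
by apply/exists_inP; exists i; rewrite ?DD'.
Qed.

Lemma separated_sym D s u v : separated D s u v = separated D s v u.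
Proof. by apply: eq_existsb => i; rewrite eq_sym (eq_sym (s u i)). Qed.

Lemma is_clashE s u v :
  is_clash s u v = (u != v) && ~~ separated [set: 'I_n] s u v.
Proof.
rewrite /is_clash; case: (u != v) => //=.
rewrite negb_exists; apply/eqP/forallP => [/ffunP H i|H].
  move: (H i); rewrite !ffunE finset.in_setT.
  by case: (u i) (v i) (s u i) (s v i) => [] [] [] [].
apply/ffunP => i; move: (H i); rewrite !ffunE finset.in_setT.
by case: (u i) (v i) (s u i) (s v i) => [] [] [] [].
Qed.

End Agreement.

(** * Partial orientations maintained by the adversary *)

Section Orientation.
Variable n : nat.
Implicit Types (h : seq (cube n)) (D L : {set 'I_n}) (st : outmap n).
Implicit Types (u v w : cube n).

(* An orientation of the face spanned by L, copied to all parallel faces, with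
   every edge in a direction outside L made outgoing at both its ends.  The
   latter edges are still free, and no two queries of h share an L-projection,
   so each query can still become the source of its face in the directions
   outside L. *)
Record orients h L st : Prop := Orients {
  orients_out : forall v i, i \notin L -> st v i;
  orients_local : forall u v, agree L u v -> st u = st v;
  orients_sep : forall u v, ~~ agree L u v -> separated L st u v;
  orients_inj : {in h &, forall u v, agree L u v -> u = v} }.

Lemma orients0 : orients [::] finset.set0 [ffun=> [ffun=> true]].
Proof.
split=> // [v i _|u v _|u v]; rewrite ?ffunE //.
by rewrite (_ : agree _ u v) //; apply/agreeP => i; rewrite inE.
Qed.

Lemma orients_cons h L st w :
    orients h L st -> {in h, forall v, agree L v w -> v = w} ->
  orients (w :: h) L st.
Proof.
move=> [st1 stL stS stI] wh; split=> // u v; rewrite !inE.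
move=> /orP[/eqP->|uh] /orP[/eqP->|vh] //.
- by rewrite agree_sym => /wh->.
- exact: wh.
- exact: stI.
Qed.

(* At the L-projection of a query v the new edge leaves v, which keeps the
   answer given at v. *)
Lemma orients_extend h L st i :
    orients h L st -> i \notin L ->
  exists2 st', orients h (i |: L) st' & {in h, st' =1 st}.
Proof.
move=> [st1 stL stS stI] iL.
pose g u := has (fun v => agree L v u && ~~ v i) h.
have gL u v : agree L u v -> g u = g v.
  move=> uv; apply: eq_has => w; congr (_ && _).
  by rewrite ![agree L w _]agree_sym (agree_eql uv).
pose st' : outmap n :=
    [ffun u : cube n => [ffun j => if j == i then u i (+) g u else st u j]].
have st'i u : st' u i = u i (+) g u by rewrite !ffunE eqxx.
have st'j u j : j != i -> st' u j = st u j by rewrite !ffunE => /negbTE->.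
exists st'; first split.
- move=> v j; rewrite in_setU1 negb_or => /andP[ji jL].
  by rewrite st'j // st1.
- move=> u v; rewrite agreeU1 => /andP[/eqP ui uv]; apply/ffunP => j.
  have [->|ji] := eqVneq j i; first by rewrite !st'i ui (gL _ _ uv).
  by rewrite !st'j // (stL _ _ uv).
- move=> u v; rewrite agreeU1 negb_and orbC.
  case: (boolP (agree L u v)) => [uv /= ui|/stS/exists_inP[j jL sj] _].
    apply/exists_inP; exists i; first exact: setU11.
    rewrite ui !st'i (gL _ _ uv) /=.
    by case: (u i) (v i) (g v) ui => [] [] [].
  apply/exists_inP; exists j; first exact: setU1r.
  by rewrite !st'j //; apply: contraNneq iL => <-.
- by move=> u v uh vh; rewrite agreeU1 => /andP[_]; exact: stI.
- move=> v vh; apply/ffunP => j.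
  have [->|ji] := eqVneq j i; last by rewrite st'j.
  rewrite st'i st1 // /g; case: (boolP (v i)) => vi /=.
    apply/hasPn => w wh; apply/negP => /andP[wv].
    by rewrite (stI w v) // vi.
  by apply/hasP; exists v => //; rewrite agreexx.
Qed.

(** By [orients_inj], all queries of [h] that share the [L]-projection of [w] coincide, so one new
    direction suffices to tell [w] from them. *)
Lemma orients_query h L st w :
    orients h L st ->
  exists L' st', [/\ orients (w :: h) L' st', {in h, st' =1 st}
                   & #|L'| <= #|L|.+1].
Proof.
move=> stP.
case: (boolP (has (fun v => agree L v w && (v != w)) h)); last first.
  move=> /hasPn H; exists L, st; split=> //; apply: orients_cons => // v /H.
  by rewrite negb_and negbK => + vw; rewrite vw => /eqP.
move=> /hasP[v vh /andP[vw neq]].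
have [i iL vi] : exists2 i, i \notin L & v i != w i.
  have: ~~ agree (~: L) v w by apply: contraNN neq => /(agree_setC vw)->.
  by rewrite negb_forall_in => /exists_inP[i]; rewrite inE; exists i.
have [st' stP1 E] := orients_extend stP iL.
exists (i |: L), st'; split=> //; last by rewrite cardsU1 iL.
apply: orients_cons => // u uh; rewrite agreeU1 => /andP[ui uw].
have uv : u = v.
  by apply: (orients_inj stP) => //; apply: agree_trans uw _; rewrite agree_sym.
by rewrite -uv ui in vi.
Qed.

Lemma orients_enlarge h L st m :
    orients h L st -> #|L| <= m -> m <= n ->
  exists L' st', [/\ orients h L' st', {in h, st' =1 st} & #|L'| = m].
Proof.
move=> stP; elim: m => [|m IH]; first by rewrite leqn0 => /eqP L0; exists L, st.
rewrite leq_eqVlt => /orP[/eqP Lm _|Lm mn]; first by exists L, st.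
have [L' [st' [stP1 E cL']]] := IH Lm (ltnW mn).
have [i iL] : exists i, i \in ~: L'.
  apply/finset.set0Pn.
  by rewrite -card_gt0 cardsCs finset.setCK cL' card_ord subn_gt0.
rewrite inE in iL; have [st'' stP2 E'] := orients_extend stP1 iL.
exists (i |: L'), st''; split=> //; last by rewrite cardsU1 iL cL'.
by move=> v vh; rewrite E' // E.
Qed.

(** Pigeonhole: each vertex of [h] rules out only one subset of [D], its trace [T v], and [D] has
    more than [size h] subsets. *)
Lemma exists_avoiding h D :
  size h < 2 ^ #|D| -> exists x : cube n, {in h, forall v, ~~ agree D v x}.
Proof.
move=> hD; pose T v : {set 'I_n} := [set i in D | v i].
have [S SD Sh] : exists2 S, S \in powerset D & S \notin map T h.
  apply/exists_inP; apply: contraTT hD; rewrite negb_exists_in -leqNgt.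
  move=> /forall_inP H; rewrite -card_powerset -(size_map T) cardE.
  apply: uniq_leq_size; first exact: enum_uniq.
  by move=> S; rewrite mem_enum => /H; rewrite negbK.
exists [ffun i => i \in S] => v vh; apply: contra Sh => /agreeP vx.
apply/mapP; exists v => //; apply/setP => i; rewrite !inE.
case: (boolP (i \in D)) => [/vx->|iD] /=; first by rewrite ffunE.
by apply: contraNF iD; move: SD; rewrite powersetE => /fintype.subsetP; exact.
Qed.

End Orientation.

(** * Clash-free orientations with prescribed source and sink *)

Section Bipolar.
Variables (n : nat) (x : cube n).
Implicit Types (D : {set 'I_n}) (p u v w : cube n) (i : 'I_n).

(* A clash-free orientation with source p and sink x, provided p and x differ
   at i: the i-edges point to x, the facet of p is oriented away from p and the
   facet of x towards x. *)
Definition bipolar p i v : cube n :=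
  if v i == p i then [ffun j => v j == p j] else xor_vec v x.

(** Within a facet across [i] the map is XOR with a constant, so any direction in which the vertices
    differ works. For opposite facets [i] itself works: it is outgoing on the side of [p] and
    incoming on the side of [x]. *)
Lemma bipolar_sep D p i u v :
    i \in D -> p i != x i -> ~~ agree D u v ->
  exists2 j, j \in D & (u j != v j) && (bipolar p i u j != bipolar p i v j).
Proof.
move=> iD pxi uv; rewrite /bipolar.
have [j jD uvj] : exists2 j, j \in D & u j != v j.
  by move: uv; rewrite negb_forall_in => /exists_inP.
case: (boolP (u i == p i)) => ui; case: (boolP (v i == p i)) => vi.
- exists j => //; rewrite uvj !ffunE.
  by case: (u j) (v j) (p j) uvj => [] [] [].
- exists i => //; rewrite !ffunE.
  by move: pxi ui vi; case: (u i) (v i) (p i) (x i) => [] [] [] [].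
- exists i => //; rewrite !ffunE.
  by move: pxi ui vi; case: (u i) (v i) (p i) (x i) => [] [] [] [].
- exists j => //; rewrite uvj !ffunE.
  by case: (u j) (v j) (x j) uvj => [] [] [].
Qed.

Lemma bipolar_to_sink D p i v :
    i \in D -> p i != x i -> ~~ agree D v x ->
  exists2 j, j \in D & (v j != x j) && bipolar p i v j.
Proof.
move=> iD pxi; rewrite negb_forall_in /bipolar => /exists_inP[j jD vxj].
case: (boolP (v i == p i)) => vi.
  by exists i; rewrite // ffunE vi (eqP vi) pxi.
by exists j => //; rewrite vxj !ffunE; case: (v j) (x j) vxj => [] [].
Qed.

End Bipolar.

(** * Hypersinks, and transfer of an algorithm to a face *)

Section Reduction.
Variable n : nat.
Implicit Types (h q : seq (cube n)) (L : {set 'I_n}) (s : outmap n).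
Implicit Types (A : algorithm n) (u v w x : cube n).

(* The answers of s on the face itself are irrelevant: implant replaces them. *)
Record hypersink L x s : Prop := Hypersink {
  hypersink_sep : forall u v, u != v -> separated [set: 'I_n] s u v;
  hypersink_in : forall v, ~~ agree (~: L) v x ->
    exists2 i, i \notin L & (v i != x i) && s v i }.

(** The answers of [st] in [L] separate distinct [L]-projections. Vertices with a common
    [L]-projection form a face that is oriented on its own in the other directions: bipolar with the
    query as source if it contains one, uniformly towards [x] otherwise. *)
Lemma orients_hypersink h L st x :
    orients h L st -> {in h, forall v, ~~ agree (~: L) v x} ->
  exists2 s, hypersink L x s & {in h, s =1 st}.
Proof.
move=> stP hx.
have sink0 v : ~~ agree (~: L) v x ->
    exists2 j, j \in ~: L & (v j != x j) && xor_vec v x j.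
  rewrite negb_forall_in => /exists_inP[j jD vxj]; exists j => //.
  by rewrite vxj ffunE; case: (v j) (x j) vxj => [] [].
(* [c] is constant on each such face: it returns the query there, unique by [orients_inj], with a
   direction outside [L] in which it differs from [x]. *)
have [c cP] : exists c : cube n -> option (cube n * 'I_n),
    [/\ forall u v, agree L u v -> c u = c v,
        {in h, forall v, exists2 i, c v = Some (v, i) & i \in ~: L} &
        forall v p i, c v = Some (p, i) -> i \in ~: L /\ p i != x i].
  pose far p := [pick i in ~: L | p i != x i].
  exists (fun v => if [pick p in h | agree L v p] is Some p
                   then omap (pair p) (far p) else None); split.
  - move=> u v uv; rewrite (@eq_pick _ _ [pred p in h | agree L v p]) //.
    by move=> p /=; rewrite (agree_eql uv).
  - move=> v vh; case: pickP => [p /andP[ph vp]|/(_ v)]; last first.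
      by rewrite vh agreexx.
    rewrite -(orients_inj stP vh ph vp) /far.
    case: pickP => [i /andP[iL _]|H]; first by exists i.
    have /exists_inP[i iL vi] : [exists i in ~: L, v i != x i].
      by rewrite -negb_forall_in hx.
    by have := H i; rewrite iL vi.
  - move=> v p i; case: pickP => // p' _; rewrite /far.
    by case: pickP => //= j /andP[jL pj] [<- <-].
case: cP => cL ch cx.
pose a v := if c v is Some (p, i) then bipolar x p i v else xor_vec v x.
pose s : outmap n :=
  [ffun v : cube n => [ffun i => if i \in L then st v i else a v i]].
have sL v i : i \in L -> s v i = st v i by move=> iL; rewrite !ffunE iL.
have sC v i : i \in ~: L -> s v i = a v i.
  by rewrite inE !ffunE => /negbTE->.
exists s; first split.
- move=> u v uv.
  case: (boolP (agree L u v)) => [Luv|/(orients_sep stP)]; last first.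
    move=> /exists_inP[i iL suv]; apply/exists_inP; exists i => //.
    by rewrite !sL.
  have Cuv : ~~ agree (~: L) u v by apply: contraNN uv => /(agree_setC Luv)->.
  have [i iL auv] : exists2 i, i \in ~: L & (u i != v i) && (a u i != a v i).
    rewrite /a (cL _ _ Luv); case E : (c v) => [[p j]|].
      by have [jL pj] := cx _ _ _ E; exact: bipolar_sep.
    move: Cuv; rewrite negb_forall_in => /exists_inP[j jL uvj]; exists j => //.
    by rewrite uvj !ffunE; case: (u j) (v j) (x j) uvj => [] [] [].
  by apply/exists_inP; exists i => //; rewrite !sC.
- move=> v vx.
  have [i iL av] : exists2 i, i \in ~: L & (v i != x i) && a v i.
    rewrite /a; case E : (c v) => [[p j]|]; last exact: sink0.
    by have [jL pj] := cx _ _ _ E; exact: bipolar_to_sink.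
  by exists i; rewrite ?sC //; rewrite inE in iL.
- move=> v vh; apply/ffunP => i.
  case: (boolP (i \in L)) => iL; first by rewrite sL.
  rewrite sC ?inE // (orients_out stP) // /a.
  (* A query is the source of its own face, which matches the outgoing answers of [st] outside
     [L]. *)
  by have [j -> _] := ch v vh; rewrite /bipolar eqxx ffunE eqxx.
Qed.

Definition face_coord L v : cube #|L| := [ffun j => v (enum_val j)].

(** The default [false] makes every direction outside [L] incoming on the face. *)
Definition face_answer L (a : cube #|L|) : cube n :=
  [ffun i => if [pick j | enum_val j == i] is Some j then a j else false].

Lemma face_answerE L (a : cube #|L|) j : face_answer a (enum_val j) = a j.
Proof.
rewrite ffunE; case: pickP => [k /eqP/enum_val_inj->//|/(_ j)].
by rewrite eqxx.
Qed.

Lemma face_answer_out L (a : cube #|L|) i :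
  i \notin L -> face_answer a i = false.
Proof.
move=> iL; rewrite ffunE; case: pickP => // j /eqP E.
by rewrite -E enum_valP in iL.
Qed.

Lemma face_coord_inj L u v :
  agree (~: L) u v -> face_coord L u = face_coord L v -> u = v.
Proof.
move=> uv /ffunP E; apply: agree_setC uv; apply/agreeP => i iL.
by have := E (enum_rank_in iL i); rewrite !ffunE enum_rankK_in.
Qed.

Definition implant L x s (s' : outmap #|L|) : outmap n :=
  [ffun v => if agree (~: L) v x
             then face_answer (s' (face_coord L v)) else s v].

(** Simulates [A] on the implanted outmap; queries off the face are answered by [s] at no cost. *)
Fixpoint restrict L x s A : algorithm #|L| :=
  if A is Query u next then
    if agree (~: L) u x
    then Query (face_coord L u) (fun a => restrict L x s (next (face_answer a)))
    else restrict L x s (next (s u))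
  else Stop.

Lemma queries_restrict L x s (s' : outmap #|L|) A :
  queries (restrict L x s A) s' =
  [seq face_coord L v | v <- queries A (implant x s s') & agree (~: L) v x].
Proof.
elim: A => //= u next IH; rewrite [implant _ _ _ u]ffunE.
by case: ifP => _ /=; rewrite IH.
Qed.

(** A vertex off the face is no sink, having the outgoing edge of [hypersink_in], and is in no
    clash: the direction of that edge separates it from face vertices, and [s] separates it from
    other vertices off the face. *)
Lemma found_implant L x s (s' : outmap #|L|) q :
    hypersink L x s -> found (implant x s s') q ->
  found s' [seq face_coord L v | v <- q & agree (~: L) v x].
Proof.
move=> [sepF inF].
have coord_mem v : v \in q -> agree (~: L) v x ->
    face_coord L v \in [seq face_coord L v | v <- q & agree (~: L) v x].
  by move=> vq vx; apply: map_f; rewrite mem_filter vx.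
have crossing u v : agree (~: L) u x -> ~~ agree (~: L) v x ->
    separated [set: 'I_n] (implant x s s') u v.
  move=> ux vx; have [i iL /andP[vxi svi]] := inF v vx.
  apply/exists_inP; exists i; rewrite ?finset.in_setT //.
  rewrite [implant _ _ _ u]ffunE [implant _ _ _ v]ffunE ux (negbTE vx).
  rewrite face_answer_out // svi andbT.
  by move/agreeP: ux => ->; rewrite ?inE // eq_sym.
case/orP => /exists_inP[u uq].
  rewrite /is_sink ffunE; case: (boolP (agree (~: L) u x)) => ux.
    move=> /eqP/ffunP E; apply/orP; left; apply/exists_inP.
    exists (face_coord L u); first exact: coord_mem.
    apply/eqP/ffunP => j; have := E (enum_val j).
    by rewrite face_answerE !ffunE.
  have [i _ /andP[_ +]] := inF u ux; move=> sui /eqP/ffunP/(_ i).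
  by rewrite sui ffunE.
move=> /exists_inP[v vq]; rewrite is_clashE => /andP[uv].
case: (boolP (agree (~: L) u x)) => ux; case: (boolP (agree (~: L) v x)) => vx.
- move=> nsep; apply/orP; right; apply/exists_inP.
  exists (face_coord L u); first exact: coord_mem.
  apply/exists_inP; exists (face_coord L v); first exact: coord_mem.
  rewrite is_clashE; apply/andP; split.
    apply: contraNN uv => /eqP/face_coord_inj->//.
    by apply: agree_trans ux _; rewrite agree_sym.
  apply: contraNN nsep => /exists_inP[j _ sj]; apply/exists_inP.
  exists (enum_val j); rewrite ?finset.in_setT //; move: sj.
  rewrite ![face_coord L _ j]ffunE.
  by rewrite [implant _ _ _ u]ffunE [implant _ _ _ v]ffunE ux vx !face_answerE.
- by rewrite crossing.
- by rewrite separated_sym crossing.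
- suff -> : separated [set: 'I_n] (implant x s s') u v =
            separated [set: 'I_n] s u v by rewrite sepF.
  apply: eq_existsb => i.
  rewrite [implant _ _ _ u]ffunE [implant _ _ _ v]ffunE.
  by rewrite (negbTE ux) (negbTE vx).
Qed.

(** [A'] is what remains of [A] after the queries [h], stored latest first; every outmap with the
    same answers on [h] follows the same branch. Stopping early is excluded only in
    [t_recurrence]. *)
Lemma adversary A m :
  exists h L st A',
    [/\ orients h L st, #|L| <= size h <= m, A' = Stop \/ size h = m &
        forall s, {in h, s =1 st} -> queries A s = rev h ++ queries A' s].
Proof.
elim: m => [|m [h [L [st [A' [stP /andP[Lh hm] end_h run]]]]]].
  by exists [::], finset.set0, [ffun=> [ffun=> true]], A; split;
    [exact: orients0|rewrite cards0|right|].
case: A' end_h run => [|w next] end_h run.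
  exists h, L, st, Stop; split => //; last by left.
  by rewrite Lh (leq_trans hm).
case: end_h => // hm'.
have [L' [st' [stP' E cL']]] := orients_query w stP.
exists (w :: h), L', st', (next (st' w)); split=> //=.
- by rewrite (leq_trans cL') ?ltnS // -hm'.
- by right; rewrite hm'.
- move=> s sh; rewrite run => [|v vh]; last first.
    by rewrite sh ?E // inE vh orbT.
  by rewrite /= sh ?mem_head // rev_cons cat_rcons.
Qed.

(** * The recurrence for [t] *)

Lemma t_le_worst_case A : solves_sink_or_clash A -> t n <= worst_case A.
Proof.
rewrite /t; case: ex_minnP => k _ + solA; apply.
by apply/asboolP; exists A.
Qed.

Lemma t_attained :
  exists2 A : algorithm n, solves_sink_or_clash A & worst_case A = t n.
Proof. by rewrite /t; case: ex_minnP => k /asboolP[A [? ?]] _; exists A. Qed.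

End Reduction.

Lemma t_recurrence (n n' m : nat) :
  n' <= n -> m <= n' -> m < 2 ^ (n - n') -> m + t n' <= t n.
Proof.
move=> n'n mn' m2; have [A solA <-] := t_attained n.
have [h [L0 [st0 [A' [stP0 /andP[L0h hm] end_h run]]]]] := adversary A m.
have [L [st [stP E cL]]] :=
  orients_enlarge stP0 (leq_trans L0h (leq_trans hm mn')) n'n.
have cLC : #|~: L| = n - n' by rewrite cardsCs finset.setCK cL card_ord.
have [x hx] : exists x, {in h, forall v, ~~ agree (~: L) v x}.
  by apply: exists_avoiding; rewrite cLC (leq_ltn_trans hm).
have [s sP Es] := orients_hypersink stP hx.
have im_h (s' : outmap #|L|) : {in h, implant x s s' =1 st0}.
  by move=> v vh; rewrite ffunE (negbTE (hx v vh)) Es ?E.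
have rev_off : [seq v <- rev h | agree (~: L) v x] = [::].
  by apply/eqP; rewrite -[_ == _]negbK -has_filter has_rev; apply/hasPn.
pose B := restrict L x s A'.
have qB (s' : outmap #|L|) : queries B s' =
    [seq face_coord L v | v <- queries A (implant x s s') & agree (~: L) v x].
  by rewrite queries_restrict run ?filter_cat ?rev_off.
have solB : solves_sink_or_clash B.
  apply/forallP => s'; rewrite qB; apply: found_implant sP _.
  by move/forallP: solA; apply.
(* Stopping early would make [B] a solution without queries, but [found] fails on the empty
   sequence. *)
have {end_h} hm' : size h = m.
  case: end_h => // A'E; move/forallP/(_ [ffun=> zero_vec _]): solB.
  rewrite /B A'E /=; case/orP => /exists_inP[u] //.
rewrite -{1}cL (leq_trans (leq_add (leqnn m) (t_le_worst_case solB))) //.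
have [s' ->] : exists s', worst_case B = nqueries B s'.
  have /(_ _)[|s' _ E'] := @eq_bigmax_cond _ predT (nqueries B).
    by apply/card_gt0P; exists [ffun=> zero_vec _].
  by exists s'.
(* On the implanted outmap, [A] makes [m] queries off the face and then at least those of [B]. *)
apply: leq_trans (leq_bigmax (implant x s s')).
rewrite /nqueries qB run // filter_cat rev_off /= size_map size_cat size_rev.
by rewrite hm' leq_add2l size_filter count_size.
Qed.

(** * Iteration of the recurrence and choice of parameters *)

(** Each step lowers the dimension by [d] and gains [M] queries; ending at dimension [M] keeps the
    side condition [m <= n'] of the recurrence true throughout. *)
Lemma t_linear_steps (M d r : nat) : M < 2 ^ d -> r * M <= t (M + r * d).
Proof.
move=> Md; elim: r => [//|r IH]; rewrite mulSn.
apply: leq_trans (leq_add (leqnn M) IH) _.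
by apply: t_recurrence; rewrite ?mulSn; [lia|lia|rewrite addnCA addnK].
Qed.

Lemma t_quadratic (n : nat) : 8 <= n -> n ^ 2 <= 16 * trunc_log 2 n * t n.
Proof.
move=> n8; set l := trunc_log 2 n.
have l3 : 3 <= l by rewrite -[3]/(trunc_log 2 8) leq_trunc_log.
have [ln nl] : 2 ^ l <= n /\ n < 2 ^ l.+1.
  by apply/andP; apply: trunc_log_bounds; lia.
(* Equality holds at [l = 3], whence the threshold 8; the bound makes [r] below positive. *)
have l2 : 2 * l.+1 <= 2 ^ l.
  elim: (l) l3 => // k IH; rewrite ltnS leq_eqVlt => /orP[/eqP<-//|/IH].
  by rewrite !expnS; lia.
(* The divisor [2 * d] lets the [r] steps consume at most half of the dimension, so [M = n - r * d]
   is at least half of [n]. As [r] is positive, rounding down loses at most a factor 2, which gives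
   [nrd]. *)
set d := l.+1 in nl l2; set r := n %/ (2 * d).
have rd : r * (2 * d) <= n by exact: leq_divM.
have r0 : 0 < r by rewrite divn_gt0 //; lia.
have nrd : n <= 4 * (r * d).
  by have := @ltn_ceil n (2 * d) isT; rewrite -/r; nia.
have := @t_linear_steps (n - r * d) d r; rewrite subnK; last by lia.
move=> /(_ (leq_ltn_trans (leq_subr _ _) nl)) tn.
apply: (@leq_trans (4 * (r * d) * (2 * (n - r * d)))).
  by rewrite -mulnn; apply: leq_mul; lia.
apply: (@leq_trans (8 * d * t n)); first by nia.
by rewrite leq_mul // /d; lia.
Qed.

(** * Passage to the asymptotic statement *)

Local Open Scope classical_set_scope.
Local Open Scope ring_scope.

Lemma trunc_log_le_ln (R : realType) (n : nat) :
  (0 < n)%N -> (trunc_log 2 n)%:R * ln 2 <= ln (n%:R : R).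
Proof.
move=> n0; rewrite mulr_natl -lnXn // ler_ln ?posrE ?exprn_gt0 ?ltr0n //.
by rewrite -natrX ler_nat trunc_logP.
Qed.

Theorem corollary19 (R : realType) :
  (fun n : nat => (t n)%:R : R)
    \is 'Omega_\oo (fun n : nat => n%:R ^+ 2 / ln (n%:R : R) : R).
Proof.
have ln2_gt0 : 0 < ln (2 : R) by rewrite ln_gt0 // ltr1n.
(* The 16 is that of [t_quadratic]; [ln 2] converts the binary logarithm to the natural one. *)
rewrite qualifE; apply/asboolP; exists (ln 2 / 16); first by rewrite divr_gt0.
near=> n.
have n8 : (8 <= n)%N by near: n; exact: nbhs_infty_ge.
have lnn_gt0 : 0 < ln (n%:R : R) by rewrite ln_gt0 // ltr1n; lia.
rewrite !ger0_norm ?divr_ge0 ?exprn_ge0 ?(ltW lnn_gt0) //.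
rewrite mulrA ler_pdivrMr //.
have := t_quadratic n8; rewrite -(ler_nat R) natrX !natrM => tq.
have := @trunc_log_le_ln R n (leq_trans (isT : (0 < 8)%N) n8) => lnq.
have t0 : 0 <= (t n)%:R :> R by [].
nra.
Unshelve. all: by end_near.
Qed.
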